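(* Fix a prompt $x_0$ and $N\ge 1$. Let $(y_0^i,c_0^i,x_1^i,y_1^i)$, $i=1,\dots,N$, be i.i.d. given $x_0$, with $y_0^i\sim\pi(\cdot\mid x_0)$, $c_0^i\sim\mathcal{M}(\cdot\mid x_0,y_0^i)$, $x_1^i=f(x_0,y_0^i,c_0^i)$, $y_1^i\sim\pi(\cdot\mid x_1^i)$, and let $r_0^i:=r(x_0,y_0^i)$, $r_1^i:=r(x_0,y_1^i)$. Define the first-turn mean baseline and advantages $$\bar r_0:=\frac1N\sum_{j=1}^N r_0^j,\qquad A_i^{(0)}:=r_1^i-\bar r_0,$$ and the importance-corrected gradient estimator $$\hat G^{(1)}:=\frac1N\sum_{i=1}^N\frac{\pi(y_1^i\mid x_0)}{\pi(y_1^i\mid x_1^i)}\,A_i^{(0)}\,\nabla\log\pi(y_1^i\mid x_0).$$ Then $$\mathbb{E}\big[\hat G^{(1)}\mid x_0\big]=\nabla\,\mathbb{E}_{y\sim\pi(\cdot\mid x_0)}\big[r(x_0,y)\big].$$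
   Context: $\mathcal{X}$ is a space of prompts, $\mathcal{Y}$ a space of outputs, $\mathcal{C}$ a space of text feedback. A policy $\pi=\pi_\theta$, with parameter $\theta$ in a Euclidean space, assigns to each prompt $x$ a probability distribution $\pi(\cdot\mid x)$ on $\mathcal{Y}$ (given by a mass function or density, also written $\pi(y\mid x)$); $\nabla$ denotes the gradient with respect to $\theta$. The feedback provider $\mathcal{M}$ assigns to each (prompt, output) pair a probability distribution on $\mathcal{C}$. The map $f$ produces the next prompt $x_1=f(x_0,y_0,c_0)\in\mathcal{X}$ from the prompt, the output and the feedback. The reward is a function $r(x_0,y)\in[0,1]$. All sampling is done with the current parameter $\theta$, at which $\hat G^{(1)}$ and the gradients are evaluated. Standing assumptions: (support condition) for every second-turn prompt $x_1$ that can arise, $\pi(y\mid x_0)>0$ implies $\pi(y\mid x_1)>0$; (regularity) $\theta\mapsto\pi_\theta(y\mid x_0)$ is differentiable, differentiation in $\theta$ may be interchanged with the integrals (or sums) $\int\pi_\theta(y\mid x_0)\,dy$ and $\int r(x_0,y)\pi_\theta(y\mid x_0)\,dy$, and the expectations that appear are absolutely convergent. *)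

(* Defs.v *)
From HB Require Import structures.
From mathcomp Require Import all_boot all_order all_algebra.
From mathcomp Require Import all_classical all_reals all_analysis.

Set Implicit Arguments.
Unset Strict Implicit.
Unset Printing Implicit Defensive.

Import Order.TTheory GRing.Theory Num.Theory.
Import numFieldNormedType.Exports.

Local Open Scope classical_set_scope.
Local Open Scope ring_scope.

(* Densities are taken with respect to a sigma-finite reference measure [mu]:
   counting measure for mass functions, Lebesgue measure for usual densities.
   Joint measurability in (prompt, output) is what makes the policy usable at a
   random second-turn prompt. *)
Record policy (R : realType) (p : nat) (dX dY : measure_display)
    (X : measurableType dX) (Y : measurableType dY)
    (mu : {sigma_finite_measure set Y -> \bar R}) := Policy {
  density :> 'rV[R]_p -> X -> Y -> R ;
  density_ge0 : forall t x y, 0 <= density t x y ;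
  density_measurable : forall t,
    measurable_fun [set: X * Y] (fun xy => density t xy.1 xy.2) ;
  density_integral1 : forall t x, (\int[mu]_y (density t x y)%:E = 1)%E }.

Arguments policy R p {dX dY} X {Y} mu.

Definition grad (R : realType) (p : nat) (F : 'rV[R]_p -> R) (t : 'rV[R]_p) :
    'rV[R]_p :=
  \row_k 'D_(delta_mx 0 k) F t.

(* The gradient at [t] of the integral of [g _ y] over [y] exists and is the
   absolutely convergent integral of the gradients. *)
Definition grad_integral_interchange (R : realType) (p : nat)
    (dY : measure_display) (Y : measurableType dY)
    (mu : {measure set Y -> \bar R}) (g : 'rV[R]_p -> Y -> R) (t : 'rV[R]_p) :=
  [/\ forall k, mu.-integrable [set: Y] (fun y => (grad (g ^~ y) t 0 k)%:E),
      differentiable (fun s => \int[mu]_y g s y) t &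
      grad (fun s => \int[mu]_y g s y) t
        = \row_k \int[mu]_y grad (g ^~ y) t 0 k].

Section Trajectories.
Variables (R : realType) (p : nat) (dX dY dC : measure_display).
Variables (X : measurableType dX) (Y : measurableType dY).
Variables (C : measurableType dC).
Variable mu : {sigma_finite_measure set Y -> \bar R}.
Variable pi : policy R p X mu.
Variable M : R.-pker (X * Y)%type ~> C.
Variable f : X * Y * C -> X.
Variable r : X -> Y -> R.
Variable theta : 'rV[R]_p.
Variable x0 : X.

(* Law of (y_0, c_0, y_1); x_1 = f (x_0, y_0, c_0) is a function of these. *)
Definition trajectory_law (E : set (Y * C * Y)) : \bar R :=
  (\int[mu]_y0 ((pi theta x0 y0)%:E *
    \int[M (x0, y0)]_c0
      \int[mu]_y1 ((pi theta (f (x0, y0, c0)) y1)%:E *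
                   (\1_E (y0, c0, y1))%:E)))%E.

(* "x_1 can arise" means up to a null set of first turns (y_0, c_0). *)
Definition support_condition : Prop :=
  {ae mu, forall y0, 0 < pi theta x0 y0 ->
    {ae M (x0, y0), forall c0,
      forall y, 0 < pi theta x0 y -> 0 < pi theta (f (x0, y0, c0)) y}}.

Definition expected_reward (t : 'rV[R]_p) : R :=
  \int[mu]_y (r x0 y * pi t x0 y).

Section Estimator.
Variables (N : nat) (y0 : 'I_N -> Y) (c0 : 'I_N -> C) (y1 : 'I_N -> Y).

Definition second_prompt (i : 'I_N) : X := f (x0, y0 i, c0 i).

Definition mean_first_reward : R := N%:R^-1 * \sum_(j < N) r x0 (y0 j).

Definition advantage (i : 'I_N) : R := r x0 (y1 i) - mean_first_reward.

(* The library has [ln 0 = 0]: where [pi theta x0 (y1 i) = 0] the gradient of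
   the logarithm carries no meaning, but its coefficient is then 0. *)
Definition gradient_estimator : 'rV[R]_p :=
  N%:R^-1 *: \sum_(i < N)
    ((pi theta x0 (y1 i) / pi theta (second_prompt i) (y1 i) * advantage i)
     *: grad (fun t => ln (pi t x0 (y1 i))) theta).

End Estimator.
End Trajectories.

Definition mutually_independent (R : realType) (d d' : measure_display)
    (Omega : measurableType d) (T : measurableType d')
    (P : probability Omega R) (N : nat) (Z : 'I_N -> Omega -> T) : Prop :=
  forall (J : {set 'I_N}) (E : 'I_N -> set T),
    (forall i, measurable (E i)) ->
    P (\bigcap_(i in [set` J]) (Z i @^-1` E i))
      = (\prod_(i in J) fine (P (Z i @^-1` E i)))%:E.

(* Main.v *)
(** Writing [D] for a partial derivative of the density [pi(. | x0)], the
    importance weight times the score is [D(y1) / pi(y1 | x1)]: this holds also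
    where [pi(y1 | x0) = 0], because the nonnegative density is minimal there
    and [D] vanishes.  Integrating against the law of a trajectory cancels
    [pi(y1 | x1)], so for nonnegative [a] and [b], with [b] vanishing where
    [pi(. | x0)] does,
      [E (a(y0) * b(y1) / pi(y1 | x1)) = E a(y0) * int b].
    The reward term gives [int r D], the gradient of the expected reward.  The
    baseline terms all vanish since [int D] is the gradient of the constant 1:
    for [j <> i] by independence, and for [j = i] because the cancellation
    leaves no dependence between [y0] and the integral over [y1]. *)

Require Import Defs.
From HB Require Import structures.
From mathcomp Require Import all_boot all_order all_algebra.
From mathcomp Require Import all_classical all_reals all_analysis.
From mathcomp Require Import finmap measurable_realfun.

Import Order.TTheory GRing.Theory Num.Theory.
Import numFieldNormedType.Exports.

Local Open Scope classical_set_scope.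
Local Open Scope ring_scope.

(** * Positive operators on nonnegative functions and their determination by indicators *)

Section PositiveOperators.
Set Implicit Arguments.
Unset Strict Implicit.
Context {R : realType}.
Local Open Scope ereal_scope.

Definition nonneg_measurable {d} {T : measurableType d} (h : T -> \bar R) :=
  measurable_fun [set: T] h /\ forall x, 0 <= h x.

(* [trajectory_law] is an iterated integral of an indicator, and the sampling
   hypothesis identifies it with a probability on sets only.  Positive operators
   that are continuous along monotone sequences are determined by their values
   on indicators, which extends that identity to nonnegative integrands. *)
Record positive_operator {d d'} {T : measurableType d} {U : measurableType d'}
    (L : (T -> \bar R) -> U -> \bar R) : Prop := PositiveOperator {
  pos_op_measurable : forall h, nonneg_measurable h -> nonneg_measurable (L h) ;
  pos_opD : forall h g, nonneg_measurable h -> nonneg_measurable g ->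
    L (fun x => h x + g x) = fun u => L h u + L g u ;
  pos_opZ : forall (c : R) h, (0 <= c)%R -> nonneg_measurable h ->
    L (fun x => c%:E * h x) = fun u => c%:E * L h u ;
  pos_op_cvg : forall (h_ : (T -> \bar R)^nat) h,
    (forall n, nonneg_measurable (h_ n)) -> nonneg_measurable h ->
    (forall x, nondecreasing_seq (h_ ^~ x)) ->
    (forall x, h_ n x @[n --> \oo] --> h x) ->
    forall u, nondecreasing_seq (fun n => L (h_ n) u) /\
      (L (h_ n) u @[n --> \oo] --> L h u) }.

Lemma positive_operator_comp {d1 d2 d3} {T1 : measurableType d1}
    {T2 : measurableType d2} {T3 : measurableType d3}
    (L : (T2 -> \bar R) -> T3 -> \bar R) (K : (T1 -> \bar R) -> T2 -> \bar R) :
  positive_operator L -> positive_operator K ->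
  positive_operator (fun h => L (K h)).
Proof.
move=> [mL DL ZL cL] [mK DK ZK cK]; split.
- by move=> h /mK/mL.
- by move=> h g hh hg; rewrite DK// DL//; exact: mK.
- by move=> c h c0 hh; rewrite ZK// ZL//; exact: mK.
- move=> h_ h mh_ mh nd cvg u; apply: cL.
  + by move=> n; exact: mK.
  + exact: mK.
  + by move=> x; have [] := cK _ _ mh_ mh nd cvg x.
  + by move=> x; have [] := cK _ _ mh_ mh nd cvg x.
Qed.

Lemma positive_operator_mul {d} {T : measurableType d} (w : T -> R) :
  measurable_fun [set: T] w -> (forall x, (0 <= w x)%R) ->
  positive_operator (fun h x => (w x)%:E * h x).
Proof.
move=> mw w0; split.
- move=> h [mh h0]; split; last by move=> x; rewrite mule_ge0// lee_fin.
  by apply: emeasurable_funM => //; exact/measurable_EFinP.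
- by move=> h g [_ h0] [_ g0]; apply/funext => x; rewrite ge0_muleDr.
- by move=> c h c0 _; apply/funext => x; rewrite muleCA.
- move=> h_ h mh_ mh nd cvg x; split.
    by move=> m n mn; rewrite lee_wpmul2l ?lee_fin//; exact: nd.
  by apply: cvgeZl => //; exact: cvg.
Qed.

(** Continuity is monotone convergence. Measurability in the parameter [u] is a hypothesis because
    its source varies: Tonelli for the fixed measure [mu], the kernel property for [M]. The
    substitution [phi] lets the same lemma cover the expectation of [h] at a random trajectory. *)
Lemma positive_operator_integral {d1 d2 d3} {U : measurableType d1}
    {V : measurableType d2} {T : measurableType d3}
    (k : U -> {measure set V -> \bar R}) (phi : U * V -> T) :
  measurable_fun [set: U * V] phi ->
  (forall g : U * V -> \bar R, nonneg_measurable g ->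
    measurable_fun [set: U] (fun u => \int[k u]_v g (u, v))) ->
  positive_operator (fun h u => \int[k u]_v h (phi (u, v))).
Proof.
move=> mphi mk.
have mphi1 u : measurable_fun [set: V] (fun v => phi (u, v)).
  exact: measurableT_comp.
have msec (h : T -> \bar R) u : nonneg_measurable h ->
    measurable_fun [set: V] (fun v => h (phi (u, v))).
  by move=> [mh _]; exact: measurableT_comp.
split.
- move=> h [mh h0]; split; last by move=> u; exact: integral_ge0.
  by apply: (mk (fun uv => h (phi uv))); split => //; exact: measurableT_comp.
- move=> h g hh hg; apply/funext => u.
  by apply: ge0_integralD => //; do ?[exact: msec]; move=> v _;
    [exact: hh.2|exact: hg.2].
- move=> c h c0 hh; apply/funext => u.
  by rewrite ge0_integralZl//; [exact: msec|move=> v _; apply: hh.2].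
- move=> h_ h mh_ mh nd cvg u; split.
    move=> m n mn; apply: ge0_le_integral => //.
    + by move=> v _; exact: (mh_ m).2.
    + exact: msec.
    + exact: msec.
    + by move=> v _; exact: nd.
  have -> : (fun v => h (phi (u, v))) =
      (fun v => limn (fun n => h_ n (phi (u, v)))).
    by apply/funext => v; apply/esym/cvg_lim => //; exact: cvg.
  apply: (@cvg_monotone_convergence _ _ _ (k u) _ measurableT
    (fun n v => h_ n (phi (u, v)))) => //.
  + by move=> n; exact: msec.
  + by move=> n v _; exact: (mh_ n).2.
Qed.

Section uniqueness.
Context {d d'} {T : measurableType d} {U : measurableType d'}.
Variables L K : (T -> \bar R) -> U -> \bar R.
Hypotheses (posL : positive_operator L) (posK : positive_operator K).
Hypothesis LK : forall E, measurable E ->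
  L (fun x => (\1_E x)%:E) = K (fun x => (\1_E x)%:E).

Let simple (s : seq R) (E : R -> set T) x : \bar R :=
  \sum_(y <- s) y%:E * (\1_(E y) x)%:E.

Let nonneg_measurable_indic (E : set T) : measurable E ->
  nonneg_measurable (fun x => (\1_E x)%:E).
Proof.
move=> mE; split; last by move=> x; rewrite lee_fin.
by apply/measurable_EFinP; exact: measurable_indic.
Qed.

Let nonneg_measurableZ (c : R) (h : T -> \bar R) : (0 <= c)%R ->
  nonneg_measurable h -> nonneg_measurable (fun x => c%:E * h x).
Proof.
move=> c0 [mh h0]; split; last by move=> x; rewrite mule_ge0// lee_fin.
exact: measurable_funeM.
Qed.

Let nonneg_measurable_simple s E : (forall y, measurable (E y)) ->
  {in s, forall y, 0 <= y}%R -> nonneg_measurable (simple s E).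
Proof.
move=> mE s0; rewrite /simple; split; last first.
  move=> x; rewrite big_seq; apply: sume_ge0 => y ys.
  by rewrite mule_ge0 ?lee_fin// s0.
apply: emeasurable_sum => y; apply: measurable_funeM.
by apply/measurable_EFinP; exact: measurable_indic.
Qed.

Let simple_eq s E : (forall y, measurable (E y)) ->
  {in s, forall y, 0 <= y}%R -> L (simple s E) = K (simple s E).
Proof.
move=> mE; elim: s => [_|y s IH s0].
  (* A positive operator is not explicitly required to send 0 to 0; homogeneity with the scalar 0
     supplies this, so the empty sum is written as such a multiple. *)
  have -> : simple [::] E = fun x => 0%:E * (\1_(set0 : set T) x)%:E.
    by apply/funext => x; rewrite /simple big_nil mul0e.
  have m0 := nonneg_measurable_indic (@measurable0 _ T).
  rewrite (pos_opZ posL)// (pos_opZ posK)//.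
  by apply/funext => u; rewrite !mul0e.
have y0 : (0 <= y)%R by apply: s0; rewrite mem_head.
have s0' : {in s, forall y, 0 <= y}%R.
  by move=> z zs; apply: s0; rewrite inE zs orbT.
have -> : simple (y :: s) E =
    fun x => y%:E * (\1_(E y) x)%:E + simple s E x.
  by apply/funext => x; rewrite /simple big_cons.
have mI := nonneg_measurable_indic (mE y).
have mS := nonneg_measurable_simple mE s0'.
have mZ := nonneg_measurableZ y0 mI.
rewrite (pos_opD posL)// (pos_opD posK)// (pos_opZ posL)// (pos_opZ posK)//.
by rewrite LK// IH.
Qed.

Import HBNNSimple.

Let nnsfun_eq (g : {nnsfun T >-> R}) :
  L (fun x => (g x)%:E) = K (fun x => (g x)%:E).
Proof.
have -> : (fun x => (g x)%:E) =
    simple (finmap.enum_fset (fset_set (range g))) (fun y => g @^-1` [set y]).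
  apply/funext => x; rewrite fimfunE fsbig_finite//= /simple -sumEFin.
  by apply: eq_bigr => y _; rewrite EFinM.
apply: simple_eq => // y ys.
have : y \in fset_set (range g) by [].
by rewrite in_fset_set// => /set_mem[x _ <-].
Qed.

(** Additivity and homogeneity carry agreement from indicators to nonnegative simple functions. An
    increasing simple approximation of [h] then gives one sequence of values converging to both
    sides. *)
Lemma positive_operator_eq h : nonneg_measurable h -> L h = K h.
Proof.
move=> mh; have [mh1 h0] := mh.
pose h_ := nnsfun_approx measurableT mh1.
pose e n x := (h_ n x)%:E.
have me n : nonneg_measurable (e n).
  by split; [exact/measurable_EFinP|move=> x; rewrite lee_fin].
have nd x : nondecreasing_seq (e ^~ x).
  by move=> m n mn; rewrite lee_fin; exact/lefP/nd_nnsfun_approx.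
have cvg x : e n x @[n --> \oo] --> h x by exact: cvg_nnsfun_approx.
apply/funext => u.
have [_ cL] := pos_op_cvg posL me mh nd cvg u.
have [_ cK] := pos_op_cvg posK me mh nd cvg u.
apply: (cvg_unique _ cL) => //.
suff -> : (fun n => L (e n) u) = (fun n => K (e n) u) by [].
by apply/funext => n; rewrite /e nnsfun_eq.
Qed.

End uniqueness.
End PositiveOperators.

(** Inversion is discontinuous at 0, so measurability comes from the power function with exponent
    -1, which agrees with it on nonnegative reals, also at 0 where both are 0. *)
Lemma measurable_funV_ge0 {R : realType} {d} {T : measurableType d}
    (g : T -> R) :
  measurable_fun setT g -> (forall x, 0 <= g x) ->
  measurable_fun setT (fun x => (g x)^-1).
Proof.
move=> mg g0; rewrite (_ : (fun x => _) = (fun x => g x `^ (-1))).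
  exact: (measurableT_comp (measurable_powR _)).
by apply/funext => x; rewrite powR_inv1.
Qed.

(** * Directional derivatives at a minimum and of a logarithm *)

Section Derivatives.
Context {R : realType}.

(** Difference quotients from the right are nonnegative at a minimum, so every directional
    derivative is nonnegative; by linearity of the differential the directions [v] and [-v] give
    opposite values, hence 0. *)
Lemma derive_at_min_eq0 {V : normedModType R} (F : V -> R) (a v : V) :
  differentiable F a -> (forall x, F a <= F x) -> 'D_v F a = 0.
Proof.
move=> dF Fmin.
have ge0 w : 0 <= 'D_w F a.
  have Fw : derivable F a w by exact: diff_derivable.
  rewrite /derive cvg_at_rightE//.
  apply: limr_ge; first by apply: cvgP; exact: cvg_dnbhs_at_right Fw.
  near=> h; rewrite /= mulr_ge0// ?subr_ge0// invr_ge0.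
  by near: h; exact: nbhs_right_ge.
apply/eqP; rewrite eq_le ge0 andbT -oppr_ge0.
by rewrite deriveE// -linearN -deriveE.
Unshelve. all: by end_near. Qed.

Lemma derive_ln_comp {V : normedModType R} (F : V -> R) (a v : V) :
  differentiable F a -> 0 < F a ->
  'D_v (fun t => ln (F t)) a = (F a)^-1 * 'D_v F a.
Proof.
move=> dF Fa0.
have [dln lnE] := is_derive1_ln Fa0.
have dln' : differentiable (@ln R) (F a) by exact/derivable1_diffP.
rewrite deriveE; last exact: (differentiable_comp dF dln').
rewrite (diff_comp dF dln') /= diff1E// derive1E lnE.
by rewrite deriveE// mulrC.
Qed.

Lemma gradE p (F : 'rV[R]_p -> R) t k : grad F t 0 k = 'D_(delta_mx 0 k) F t.
Proof. by rewrite mxE. Qed.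
End Derivatives.

(** * Integration against the law of one trajectory, and cancellation of the second-turn density *)

Section Sampling.
Set Implicit Arguments.
Unset Strict Implicit.
Context {R : realType} {p : nat} {dX dY dC : measure_display}
  {X : measurableType dX} {Y : measurableType dY} {C : measurableType dC}
  {mu : {sigma_finite_measure set Y -> \bar R}}.
Variables (pi : policy R p X mu) (M : R.-pker (X * Y)%type ~> C).
Variables (f : X * Y * C -> X) (f_meas : measurable_fun setT f).
Variables (theta : 'rV[R]_p) (x0 : X).

Definition second_density (z : Y * C * Y) : R :=
  pi theta (f (x0, z.1.1, z.1.2)) z.2.

(** This is [trajectory_law] with the indicator replaced by a general integrand. *)
Definition trajectory_integral (h : Y * C * Y -> \bar R) : \bar R :=
  (\int[mu]_y0 ((pi theta x0 y0)%:E *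
    \int[M (x0, y0)]_c0 \int[mu]_y1
      ((second_density (y0, c0, y1))%:E * h (y0, c0, y1))))%E.

Lemma measurable_density_at (x : X) :
  measurable_fun [set: Y] (fun y => pi theta x y).
Proof.
exact: (measurableT_comp (density_measurable pi theta) (pair1_measurable x)).
Qed.

Lemma measurable_second_density :
  measurable_fun [set: Y * C * Y] second_density.
Proof.
have mg : measurable_fun [set: Y * C * Y]
    (fun z => (f (x0, z.1.1, z.1.2), z.2)).
  apply: measurable_fun_pair => //; apply: measurableT_comp => //.
  apply: measurable_fun_pair => /=; first apply: measurable_fun_pair => //.
    exact: measurableT_comp.
  exact: measurableT_comp.
exact: (measurableT_comp (density_measurable pi theta) mg).
Qed.

Lemma positive_operator_second_turn :
  positive_operator (fun (h : Y * C * Y -> \bar R) (yc : Y * C) =>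
    \int[mu]_y ((second_density (yc, y))%:E * h (yc, y)))%E.
Proof.
apply: (positive_operator_comp
  (L := fun (h : Y * C * Y -> \bar R) (yc : Y * C) => (\int[mu]_y h (yc, y))%E)
  (K := fun h z => ((second_density z)%:E * h z)%E)).
  apply: (positive_operator_integral (k := fun=> mu)
    (phi := fun z : Y * C * Y => z)) => // g [mg g0].
  exact: (@measurable_fun_fubini_tonelli_F _ _ _ _ _ mu _ mg g0).
apply: positive_operator_mul; first exact: measurable_second_density.
by move=> z; exact: density_ge0.
Qed.

Lemma positive_operator_feedback :
  positive_operator (fun (h : Y * C -> \bar R) (y : Y) =>
    \int[M (x0, y)]_c h (y, c))%E.
Proof.
apply: (positive_operator_integral (k := fun y => M (x0, y))
  (phi := fun z : Y * C => z)) => // g [mg g0].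
(* Measurability of kernel integrals is available over the whole source [X * Y] of [M]; [g] is
   extended constantly in the prompt, which is then fixed at [x0]. *)
pose g' (z : X * Y * C) := g (z.1.2, z.2).
have mg' : measurable_fun [set: X * Y * C] g'.
  apply: measurableT_comp => //; apply: measurable_fun_pair => //.
  exact: measurableT_comp.
have mMg := @measurable_fun_integral_finite_kernel _ _ _ _ _ _ M
  (fun z => g0 _) mg'.
exact: (measurableT_comp mMg (pair1_measurable x0)).
Qed.

(** Operators take values in functions, so a number-valued functional is seen as a function on
    [unit]. The functional is a composite of the three sampling stages. *)
Lemma positive_operator_trajectory :
  positive_operator (fun h (_ : unit) => trajectory_integral h).
Proof.
apply: (positive_operator_comp
  (L := fun (h : Y -> \bar R) (_ : unit) => (\int[mu]_y h y)%E)
  (K := fun h y0 => ((pi theta x0 y0)%:E * \int[M (x0, y0)]_c0 \int[mu]_y1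
      ((second_density (y0, c0, y1))%:E * h (y0, c0, y1)))%E)).
  apply: (positive_operator_integral (k := fun=> mu) (phi := snd)) => //.
apply: (positive_operator_comp
  (L := fun (h : Y -> \bar R) y0 => ((pi theta x0 y0)%:E * h y0)%E)
  (K := fun h y0 => (\int[M (x0, y0)]_c0 \int[mu]_y1
      ((second_density (y0, c0, y1))%:E * h (y0, c0, y1)))%E)).
  apply: positive_operator_mul; first exact: measurable_density_at.
  by move=> y; exact: density_ge0.
exact: (positive_operator_comp positive_operator_feedback
  positive_operator_second_turn).
Qed.

(** Both sides are positive operators in [h], and on indicators their equality is exactly the
    sampling hypothesis. *)
Lemma integral_trajectory {dO} {Omega : measurableType dO}
    (P : {measure set Omega -> \bar R}) (Z : Omega -> Y * C * Y) :
  measurable_fun setT Z ->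
  (forall E, measurable E ->
    P (Z @^-1` E) = trajectory_law pi M f theta x0 E) ->
  forall h, nonneg_measurable h ->
  (\int[P]_w h (Z w))%E = trajectory_integral h.
Proof.
move=> mZ lawZ h mh.
have posP : positive_operator
    (fun (h : Y * C * Y -> \bar R) (_ : unit) => (\int[P]_w h (Z w))%E).
  apply: (positive_operator_integral (k := fun=> P) (phi := Z \o snd)) => //.
  exact: measurableT_comp.
have := positive_operator_eq posP positive_operator_trajectory _ mh.
move=> /(_ _)/(congr1 (fun F => F tt)); apply => E mE.
apply/funext => _; rewrite [RHS]/trajectory_integral -[RHS]lawZ//.
have mZE : measurable (Z @^-1` E).
  by rewrite -[X in measurable X]setTI; exact: mZ.
by have := integral_indic P measurableT mZE; rewrite setIT.
Qed.

Lemma nonneg_measurable_importance (a b : Y -> R) :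
  measurable_fun setT a -> (forall y, 0 <= a y) ->
  measurable_fun setT b -> (forall y, 0 <= b y) ->
  nonneg_measurable
    (fun z : Y * C * Y => (a z.1.1 * (b z.2 / second_density z))%:E).
Proof.
move=> ma a0 mb b0.
have sd0 z : 0 <= second_density z by exact: density_ge0.
split; last by move=> z; rewrite lee_fin mulr_ge0// divr_ge0.
apply/measurable_EFinP; apply: measurable_funM.
  by apply: (measurableT_comp ma); exact: measurableT_comp.
apply: measurable_funM; first exact: measurableT_comp.
by apply: measurable_funV_ge0 => //; exact: measurable_second_density.
Qed.

Hypothesis supp : support_condition pi M f theta x0.

Lemma trajectory_integral_importance (a b : Y -> R) :
  measurable_fun setT a -> (forall y, 0 <= a y) ->
  measurable_fun setT b -> (forall y, 0 <= b y) ->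
  (forall y, pi theta x0 y = 0 -> b y = 0) ->
  trajectory_integral (fun z => (a z.1.1 * (b z.2 / second_density z))%:E) =
  (\int[mu]_y (a y * pi theta x0 y)%:E * \int[mu]_y (b y)%:E)%E.
Proof.
move=> ma a0 mb b0 bq0.
pose B := (\int[mu]_y (b y)%:E)%E.
pose h z := (a z.1.1 * (b z.2 / second_density z))%:E.
have mh : nonneg_measurable h by exact: nonneg_measurable_importance.
have B0 : (0 <= B)%E by apply: integral_ge0 => y _; rewrite lee_fin.
pose g2 := (fun yc : Y * C =>
  \int[mu]_y ((second_density (yc, y))%:E * h (yc, y)))%E.
have mg2 : nonneg_measurable g2.
  exact: pos_op_measurable positive_operator_second_turn _ mh.
have [mg1 g10] := pos_op_measurable positive_operator_feedback mg2.
(* Once [pi(y1 | x1)] cancels, the integral over [y1] no longer depends on the feedback, and on the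
   first output only through [a]. *)
have g2E y c : (forall y1, 0 < pi theta x0 y1 ->
    0 < pi theta (f (x0, y, c)) y1) -> g2 (y, c) = ((a y)%:E * B)%E.
  move=> spt; rewrite /g2 /B -ge0_integralZl//; last 3 first.
    - exact/measurable_EFinP.
    - by move=> y1 _; rewrite lee_fin.
    - by rewrite lee_fin.
  apply: eq_integral => y1 _; rewrite /h /= -!EFinM; congr EFin.
  (* Cancellation needs a nonzero second-turn density. The support condition provides it where
     [pi(y1 | x0)] is positive; elsewhere [b] vanishes and both sides are 0. *)
  have [q0|q0] := eqVneq (pi theta x0 y1) 0.
    by rewrite bq0// mul0r !mulr0.
  have sd : second_density (y, c, y1) != 0.
    by rewrite gt_eqF// spt// lt_neqAle eq_sym q0 density_ge0.
  by rewrite mulrCA (mulrC (b y1)) mulVKf.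
(* The integrand is almost everywhere constant in the feedback, and [M (x0, y)] has mass 1. *)
have g1E y : {ae M (x0, y), forall c, forall y1, 0 < pi theta x0 y1 ->
    0 < pi theta (f (x0, y, c)) y1} ->
    (\int[M (x0, y)]_c g2 (y, c))%E = ((a y)%:E * B)%E.
  move=> spt; transitivity (\int[M (x0, y)]_c ((a y)%:E * B))%E.
    apply: ge0_ae_eq_integral => //.
    - by apply: (measurableT_comp mg2.1).
    - by move=> c _; exact: mg2.2.
    - by move=> c _; rewrite mule_ge0// lee_fin.
    - by apply: filterS spt => c spt _; exact: g2E.
  rewrite integral_cst//.
  by rewrite [X in (_ * X)%E](@prob_kernel _ _ _ _ _ M (x0, y)) mule1.
transitivity (\int[mu]_y ((a y * pi theta x0 y)%:E * B))%E.
  apply: ge0_ae_eq_integral => //.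
  - apply: emeasurable_funM; last exact: mg1.
    by apply/measurable_EFinP; exact: measurable_density_at.
  - apply: emeasurable_funM => //; apply/measurable_EFinP.
    by apply: measurable_funM => //; exact: measurable_density_at.
  - by move=> y _; rewrite mule_ge0// lee_fin density_ge0.
  - by move=> y _; rewrite mule_ge0// lee_fin mulr_ge0// density_ge0.
  - apply: filterS supp => y spt _.
    (* The support condition says nothing about first outputs of density 0, but there the outer
       factor kills both integrands. *)
    have [q0|q0] := eqVneq (pi theta x0 y) 0.
      by rewrite q0 mulr0 !mul0e.
    rewrite [X in (_ * X)%E]g1E; last first.
      by apply: spt; rewrite lt_neqAle eq_sym q0 density_ge0.
    by rewrite muleA -EFinM mulrC.
under eq_integral do rewrite muleC.
rewrite ge0_integralZl// 1?muleC//.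
- by apply/measurable_EFinP; apply: measurable_funM => //;
    exact: measurable_density_at.
- by move=> y _; rewrite lee_fin mulr_ge0// density_ge0.
Qed.
Lemma integral_importance {dO} {Omega : measurableType dO}
    (P : {measure set Omega -> \bar R}) (Z : Omega -> Y * C * Y) :
  measurable_fun setT Z ->
  (forall E, measurable E ->
    P (Z @^-1` E) = trajectory_law pi M f theta x0 E) ->
  forall a b : Y -> R,
  measurable_fun setT a -> (forall y, 0 <= a y) ->
  measurable_fun setT b -> (forall y, 0 <= b y) ->
  (forall y, pi theta x0 y = 0 -> b y = 0) ->
  (\int[P]_w (a (Z w).1.1 * (b (Z w).2 / second_density (Z w)))%:E =
   \int[mu]_y (a y * pi theta x0 y)%:E * \int[mu]_y (b y)%:E)%E.
Proof.
move=> mZ lawZ a b ma a0 mb b0 bq0.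
rewrite -trajectory_integral_importance// -(integral_trajectory mZ lawZ)//.
exact: nonneg_measurable_importance.
Qed.
End Sampling.

(** * Independence, passage to signed integrands, and linearity of means *)

Section Expectation.
Set Implicit Arguments.
Unset Strict Implicit.
Context {R : realType} {dO : measure_display} {Omega : measurableType dO}.
Variable P : probability Omega R.

(** The joint law agrees with the product of the marginal laws on rectangles, hence is that product;
    Tonelli then separates the integrals. *)
Lemma ge0_integralM_independent {d1 d2} {T1 : measurableType d1}
    {T2 : measurableType d2} (Z1 : {RV P >-> T1}) (Z2 : {RV P >-> T2})
    (g1 : T1 -> \bar R) (g2 : T2 -> \bar R) :
  (forall A B, measurable A -> measurable B ->
    (P (Z1 @^-1` A `&` Z2 @^-1` B) = P (Z1 @^-1` A) * P (Z2 @^-1` B))%E) ->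
  nonneg_measurable g1 -> nonneg_measurable g2 ->
  (\int[P]_w (g1 (Z1 w) * g2 (Z2 w)) =
   \int[P]_w g1 (Z1 w) * \int[P]_w g2 (Z2 w))%E.
Proof.
move=> indep [mg1 g10] [mg2 g20].
have mZ : measurable_fun [set: Omega] (fun w => (Z1 w, Z2 w)).
  exact: measurable_fun_pair.
pose g (z : T1 * T2) := (g1 z.1 * g2 z.2)%E.
have mg : measurable_fun setT g.
  by apply: emeasurable_funM; exact: measurableT_comp.
have g0 z : (0 <= g z)%E by exact: mule_ge0.
pose m1 := distribution P Z1; pose m2 := distribution P Z2.
have lawE X : measurable X ->
    (m1 \x m2)%E X = pushforward P (fun w => (Z1 w, Z2 w)) X.
  move=> mX.
  by apply: (@product_measure_unique _ _ _ _ _ m1 m2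
    (pushforward P (fun w => (Z1 w, Z2 w)))) => // A B mA mB; exact: indep.
transitivity (\int[m1 \x m2]_z g z)%E.
  rewrite (eq_measure_integral (pushforward P (fun w => (Z1 w, Z2 w)))).
    by rewrite ge0_integral_pushforward.
  by move=> A mA _; exact: lawE.
rewrite fubini_tonelli1// /fubini_F.
transitivity (\int[m1]_x (g1 x * \int[m2]_y g2 y))%E.
  by apply: eq_integral => x _; rewrite -ge0_integralZl//.
under eq_integral do rewrite muleC.
rewrite ge0_integralZl//; last exact: integral_ge0.
by rewrite muleC !ge0_integral_distribution.
Qed.

(** The nonnegative identity applied to the absolute value of [b] gives integrability, and applied
    to the positive and negative parts it gives the signed identity. These functions still vanish on
    [S], and finiteness of [kappa] keeps the bound finite and the difference meaningful. *)
Lemma integrable_of_ge0 {d} {T : measurableType d}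
    (mu : {measure set T -> \bar R}) (S : T -> Prop) (W : Omega -> R)
    (V : Omega -> T) (kappa : \bar R) :
  measurable_fun setT W -> (forall w, 0 <= W w) -> measurable_fun setT V ->
  kappa \is a fin_num ->
  (forall b : T -> R, measurable_fun setT b -> (forall y, 0 <= b y) ->
    (forall y, S y -> b y = 0) ->
    (\int[P]_w (W w * b (V w))%:E = kappa * \int[mu]_y (b y)%:E)%E) ->
  forall b : T -> R, mu.-integrable setT (EFin \o b) ->
  (forall y, S y -> b y = 0) ->
  P.-integrable setT (fun w => (W w * b (V w))%:E) /\
  (\int[P]_w (W w * b (V w))%:E = kappa * \int[mu]_y (b y)%:E)%E.
Proof.
move=> mW W0 mV kfin H.
have int b : mu.-integrable setT (EFin \o b) -> (forall y, S y -> b y = 0) ->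
    P.-integrable setT (fun w => (W w * b (V w))%:E).
  move=> ib bS.
  have mb : measurable_fun setT b by exact/measurable_EFinP/(measurable_int mu).
  apply/integrableP; split.
    by apply/measurable_EFinP; apply: measurable_funM => //;
      exact: measurableT_comp.
  under eq_integral do rewrite abse_EFin normrM (ger0_norm (W0 _)).
  rewrite (H (fun y => `|b y|))//; last 2 first.
  - exact: measurableT_comp.
  - by move=> y /bS ->; rewrite normr0.
  rewrite ltey_eq fin_numM//.
  exact: (integrable_fin_num measurableT (integrable_norm ib)).
move=> b ib bS; split; first exact: int.
have mb : measurable_fun setT b by exact/measurable_EFinP/(measurable_int mu).
have ipos := integrable_funrpos measurableT ib.
have ineg := integrable_funrneg measurableT ib.
have posS y : S y -> b^\+ y = 0.
  by move=> /bS; rewrite /funrpos => ->; rewrite maxxx.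
have negS y : S y -> b^\- y = 0.
  by move=> /bS; rewrite /funrneg => ->; rewrite oppr0 maxxx.
have bE y : b y = b^\+ y - b^\- y by rewrite -[in LHS](funrposBneg b).
transitivity (\int[P]_w ((W w * b^\+ (V w))%:E - (W w * b^\- (V w))%:E))%E.
  by apply: eq_integral => w _; rewrite -EFinB -mulrBr -bE.
rewrite integralB_EFin//; [|exact: int|exact: int].
have -> : (\int[mu]_y (b y)%:E = \int[mu]_y ((b^\+ y)%:E - (b^\- y)%:E))%E.
  by apply: eq_integral => y _; rewrite -EFinB -bE.
rewrite integralB_EFin//.
rewrite !H//; try exact: funrpos_ge0; try exact: funrneg_ge0; first last.
- exact: measurable_funrpos.
- exact: measurable_funrneg.
rewrite [RHS]muleBr//; apply: fin_num_adde_defl.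
by rewrite fin_numN; exact: (integrable_fin_num measurableT ineg).
Qed.

(** Integrability travels with the value so that differences and sums can be taken without separate
    side conditions. *)
Definition has_mean (Z : Omega -> R) (v : R) :=
  P.-integrable setT (EFin \o Z) /\ (\int[P]_w (Z w)%:E = v%:E)%E.

Lemma has_meanB (Z W : Omega -> R) (u v : R) :
  has_mean Z u -> has_mean W v -> has_mean (fun w => Z w - W w) (u - v).
Proof.
move=> [iZ EZ] [iW EW]; split; first exact: (integrableB _ iZ iW).
under eq_integral do rewrite EFinB.
by rewrite (integralB_EFin _ iZ iW)// EZ EW EFinB.
Qed.

Lemma has_meanZ (c : R) (Z : Omega -> R) (v : R) :
  has_mean Z v -> has_mean (fun w => c * Z w) (c * v).
Proof.
move=> [iZ EZ]; split; first exact: (integrableZl _ c iZ).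
under eq_integral do rewrite EFinM.
by rewrite (integralZl _ iZ)// EZ EFinM.
Qed.

Lemma has_mean_sum {I : Type} (s : seq I) (Z : I -> Omega -> R) (v : I -> R) :
  (forall i, has_mean (Z i) (v i)) ->
  has_mean (fun w => \sum_(i <- s) Z i w) (\sum_(i <- s) v i).
Proof.
move=> EZ; have iZ i : P.-integrable setT (EFin \o Z i) := (EZ i).1.
split.
  rewrite (_ : EFin \o _ = fun w => (\sum_(i <- s) (Z i w)%:E)%E).
    exact: (integrable_sum measurableT s (fun i _ => iZ i)).
  by apply/funext => w; rewrite sumEFin.
under eq_integral do rewrite -sumEFin.
rewrite (integral_sum measurableT iZ) -sumEFin.
by apply: eq_bigr => i _; exact: (EZ i).2.
Qed.
End Expectation.

(** * The score function and the gradient of the density *)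

Section Score.
Context {R : realType} {p : nat} {dX dY : measure_display}
  {X : measurableType dX} {Y : measurableType dY}
  {mu : {sigma_finite_measure set Y -> \bar R}}.
Variables (pi : policy R p X mu) (theta : 'rV[R]_p) (x0 : X).
Hypothesis pi_diff : forall y, differentiable (fun t => pi t x0 y) theta.

Lemma grad_density_eq0 (k : 'I_p) (y : Y) :
  pi theta x0 y = 0 -> grad (fun t => pi t x0 y) theta 0 k = 0.
Proof.
move=> q0; rewrite gradE; apply: derive_at_min_eq0 => // t.
by rewrite q0 density_ge0.
Qed.

(** Off the zeros of the density this is the logarithmic derivative; at a zero both sides are 0,
    whatever value the gradient of [ln] takes there. The denominator [s] is arbitrary, possibly
    0. *)
Lemma density_grad_ln (k : 'I_p) (y : Y) (s : R) :
  pi theta x0 y / s * grad (fun t => ln (pi t x0 y)) theta 0 k =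
  grad (fun t => pi t x0 y) theta 0 k / s.
Proof.
have [q0|qN0] := eqVneq (pi theta x0 y) 0.
  by rewrite grad_density_eq0// q0 !mul0r.
rewrite !gradE derive_ln_comp//; last first.
  by rewrite lt_neqAle eq_sym qN0 density_ge0.
by rewrite mulrACA mulrA mulrAC mulfV// mul1r mulrC.
Qed.

Lemma grad_weighted_density (c : R) (k : 'I_p) (y : Y) :
  grad (fun t => c * pi t x0 y) theta 0 k =
  c * grad (fun t => pi t x0 y) theta 0 k.
Proof. by rewrite !gradE -[RHS]deriveZ//; exact: diff_derivable. Qed.

Lemma integral_grad_density
    (swap_pi : grad_integral_interchange mu (fun t y => pi t x0 y) theta)
    (k : 'I_p) :
  \int[mu]_y grad (fun t => pi t x0 y) theta 0 k = 0.
Proof.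
have [_ _ /rowP/(_ k)] := swap_pi; rewrite [in RHS]mxE => <-.
rewrite gradE (_ : (fun t => _) = cst 1); first exact: derive_cst.
by apply/funext => t; rewrite /Rintegral density_integral1.
Qed.

End Score.

(** * Means of importance-weighted terms over the sample *)

Section Estimation.
Set Implicit Arguments.
Unset Strict Implicit.
Context {R : realType} {p : nat} {dX dY dC dO : measure_display}
  {X : measurableType dX} {Y : measurableType dY} {C : measurableType dC}
  {mu : {sigma_finite_measure set Y -> \bar R}}.
Variables (pi : policy R p X mu) (M : R.-pker (X * Y)%type ~> C).
Variables (f : X * Y * C -> X) (f_meas : measurable_fun setT f).
Variables (theta : 'rV[R]_p) (x0 : X).
Hypothesis supp : support_condition pi M f theta x0.
Context {Omega : measurableType dO} {P : probability Omega R} {N : nat}.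
Variables (y0 : 'I_N -> {RV P >-> Y}) (c0 : 'I_N -> {RV P >-> C})
  (y1 : 'I_N -> {RV P >-> Y}).
Let Z (i : 'I_N) (w : Omega) := (y0 i w, c0 i w, y1 i w).
Hypothesis sample_law : forall (i : 'I_N) (E : set (Y * C * Y)), measurable E ->
  P (Z i @^-1` E) = trajectory_law pi M f theta x0 E.
Hypothesis sample_indep : mutually_independent P Z.

Let sd (i : 'I_N) (w : Omega) := second_density pi f theta x0 (Z i w).

Lemma measurable_sample i : measurable_fun setT (Z i).
Proof.
by apply: measurable_fun_pair => //; exact: measurable_fun_pair.
Qed.

Lemma sample_pair_indep i j : i != j ->
  forall A B, measurable A -> measurable B ->
  (P (Z i @^-1` A `&` Z j @^-1` B) = P (Z i @^-1` A) * P (Z j @^-1` B))%E.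
Proof.
move=> ij A B mA mB.
(* Only the indices [i] and [j] enter the intersection; the choice of [B] at the others is
   arbitrary. *)
pose E k := if k == i then A else B.
have mE k : measurable (E k) by rewrite /E; case: ifP.
have Ei : E i = A by rewrite /E eqxx.
have Ej : E j = B by rewrite /E eq_sym (negbTE ij).
have := sample_indep [set i; j]%SET mE.
rewrite big_setU1 ?inE//= big_set1 Ei Ej.
rewrite (_ : \bigcap_(_ in _) _ = Z i @^-1` A `&` Z j @^-1` B); last first.
  rewrite -Ei -Ej; apply/seteqP; split => [w Ew|w [Eiw Ejw] k /=].
    by split; apply: Ew; rewrite /= !inE eqxx ?orbT.
  by rewrite !inE => /orP[] /eqP ->.
by move=> ->; rewrite EFinM !fineK// fin_num_measure//
  -[X in measurable X]setTI; exact: measurable_sample.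
Qed.

(** The factor is the integral of [a * pi] when [j = i], by cancellation, and the mean of [a (y0 j)]
    when [j != i], by independence. The bound [a <= 1] makes either finite. Its value stays hidden
    because it will only multiply a zero integral. *)
Let integral_importance_weight (i j : 'I_N) (a : Y -> R) :
  measurable_fun setT a -> (forall y, 0 <= a y <= 1) ->
  exists2 kappa : \bar R, kappa \is a fin_num &
  forall b : Y -> R, measurable_fun setT b -> (forall y, 0 <= b y) ->
    (forall y, pi theta x0 y = 0 -> b y = 0) ->
    (\int[P]_w (a (y0 j w) * (b (y1 i w) / sd i w))%:E =
     kappa * \int[mu]_y (b y)%:E)%E.
Proof.
move=> ma a01.
have a0 y : 0 <= a y by case/andP: (a01 y).
have a1 y : a y <= 1 by case/andP: (a01 y).
have q0 y : 0 <= pi theta x0 y by exact: density_ge0.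
have mq := measurable_density_at pi theta x0.
have [<-|ij] := eqVneq j i.
  exists (\int[mu]_y (a y * pi theta x0 y)%:E)%E; last first.
    move=> b mb b0 bq0.
    exact: (integral_importance f_meas supp (measurable_sample j)
      (sample_law j)).
  rewrite ge0_fin_numE; last first.
    by apply: integral_ge0 => y _; rewrite lee_fin mulr_ge0.
  apply: (@le_lt_trans _ _ 1%E); last exact: ltry.
  rewrite -(density_integral1 pi theta x0); apply: ge0_le_integral => //.
  - by move=> y _; rewrite lee_fin mulr_ge0.
  - by apply/measurable_EFinP; exact: measurable_funM.
  - exact/measurable_EFinP.
  - by move=> y _; rewrite lee_fin ler_piMl.
exists (\int[P]_w (a (y0 j w))%:E)%E.
  rewrite ge0_fin_numE; last first.
    by apply: integral_ge0 => w _; rewrite lee_fin.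
  apply: (@le_lt_trans _ _ 1%E); last exact: ltry.
  rewrite -(@probability_setT _ _ _ P) -[leRHS]mul1e -integral_cst//.
  apply: ge0_le_integral => //.
  - by move=> w _; rewrite lee_fin.
  - by apply/measurable_EFinP; exact: measurableT_comp.
  - by move=> w _; rewrite lee_fin.
move=> b mb b0 bq0.
pose mfunZ l : {RV P >-> (Y * C * Y)%type} :=
  HB.pack (Z l) (isMeasurableFun.Build _ _ _ _ _ (measurable_sample l)).
have mcst1 : measurable_fun [set: Y] (fun=> 1 : R) by exact: measurable_cst.
have ng1 : nonneg_measurable (fun z : Y * C * Y => (a z.1.1)%:E).
  split; last by move=> z; rewrite lee_fin.
  apply/measurable_EFinP; apply: (measurableT_comp ma).
  exact: measurableT_comp.
have ng2 := nonneg_measurable_importance pi f_meas theta x0 mcst1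
  (fun=> ler01) mb b0.
have := ge0_integralM_independent (Z1 := mfunZ j) (Z2 := mfunZ i)
  (sample_pair_indep ij) ng1 ng2.
(* With first-turn factor 1, the constant in front is the total mass of the first-turn density, so
   the second mean in the product is just the integral of [b]. *)
have := integral_importance f_meas supp (measurable_sample i) (sample_law i)
  mcst1 (fun=> ler01) mb b0 bq0.
rewrite /=; under [X in (_ = X * _)%E -> _]eq_integral do rewrite mul1r.
rewrite density_integral1 mul1e => -> <-.
by apply: eq_integral => w _; rewrite mul1r -EFinM.
Qed.

Lemma has_mean_importance (i : 'I_N) (A : Omega -> R) (kappa : \bar R) :
  measurable_fun setT A -> (forall w, 0 <= A w) -> kappa \is a fin_num ->
  (forall b : Y -> R, measurable_fun setT b -> (forall y, 0 <= b y) ->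
    (forall y, pi theta x0 y = 0 -> b y = 0) ->
    (\int[P]_w (A w * (b (y1 i w) / sd i w))%:E =
     kappa * \int[mu]_y (b y)%:E)%E) ->
  forall b : Y -> R, mu.-integrable setT (EFin \o b) ->
  (forall y, pi theta x0 y = 0 -> b y = 0) ->
  has_mean P (fun w => A w * (b (y1 i w) / sd i w))
    (fine kappa * \int[mu]_y b y).
Proof.
move=> mA A0 kfin H b ib bq0.
have sd0 w : 0 <= sd i w by exact: density_ge0.
(* Moving the inverse density into the nonnegative weight leaves [b] as a function of the second
   output alone, so that splitting [b] by sign is legitimate. *)
pose W w := A w / sd i w.
have WE (d : Y -> R) w : W w * d (y1 i w) = A w * (d (y1 i w) / sd i w).
  by rewrite /W mulrAC mulrA.
have mW : measurable_fun setT W.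
  apply: measurable_funM => //; apply: measurable_funV_ge0 => //.
  apply: (measurableT_comp _ (measurable_sample i)).
  exact: measurable_second_density.
have W0 w : 0 <= W w by exact: divr_ge0.
have HW (d : Y -> R) : measurable_fun setT d -> (forall y, 0 <= d y) ->
    (forall y, pi theta x0 y = 0 -> d y = 0) ->
    (\int[P]_w (W w * d (y1 i w))%:E = kappa * \int[mu]_y (d y)%:E)%E.
  by move=> md d0 dq0; under eq_integral do rewrite WE; exact: H.
have [iW EW] :=
  integrable_of_ge0 mW W0 (measurable_funPT (y1 i)) kfin HW ib bq0.
split; first by apply: eq_integrable iW => // w _; rewrite WE.
under eq_integral do rewrite -WE.
rewrite EW EFinM fineK// /Rintegral fineK//.
exact: (integrable_fin_num measurableT ib).
Qed.

Lemma has_mean_importance_baseline (i j : 'I_N) (a b : Y -> R) :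
  measurable_fun setT a -> (forall y, 0 <= a y <= 1) ->
  mu.-integrable setT (EFin \o b) ->
  (forall y, pi theta x0 y = 0 -> b y = 0) ->
  \int[mu]_y b y = 0 ->
  has_mean P (fun w => a (y0 j w) * (b (y1 i w) / sd i w)) 0.
Proof.
move=> ma a01 ib bq0 Ib0.
have [kappa kfin H] := integral_importance_weight i j ma a01.
rewrite -(mulr0 (fine kappa)) -Ib0; apply: has_mean_importance => //.
  exact: measurableT_comp.
by move=> w; case/andP: (a01 (y0 j w)).
Qed.

Lemma has_mean_importance_reward (i : 'I_N) (b : Y -> R) :
  mu.-integrable setT (EFin \o b) ->
  (forall y, pi theta x0 y = 0 -> b y = 0) ->
  has_mean P (fun w => b (y1 i w) / sd i w) (\int[mu]_y b y).
Proof.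
move=> ib bq0; rewrite -[X in has_mean _ _ X](mul1r _).
under [X in has_mean _ X _]funext do rewrite -[_ / _]mul1r.
apply: (has_mean_importance (kappa := 1%E)) => // d md d0 dq0.
have := integral_importance f_meas supp (measurable_sample i) (sample_law i)
  (measurable_cst (1 : R)) (fun=> ler01) md d0 dq0.
move=> /= ->; congr (_ * _)%E.
by under eq_integral do rewrite mul1r; exact: density_integral1.
Qed.

End Estimation.

(** * Unbiasedness, one coordinate of the gradient at a time *)

Theorem propositionB2 (R : realType) (p : nat)
  (dX dY dC dO : measure_display)
  (X : measurableType dX) (Y : measurableType dY) (C : measurableType dC)
  (mu : {sigma_finite_measure set Y -> \bar R})
  (pi : policy R p X mu)
  (M : R.-pker (X * Y)%type ~> C)
  (f : X * Y * C -> X) (f_meas : measurable_fun setT f)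
  (r : X -> Y -> R) (r01 : forall x y, 0 <= r x y <= 1)
  (r_meas : measurable_fun [set: X * Y] (fun xy => r xy.1 xy.2))
  (theta : 'rV[R]_p) (x0 : X)
  (supp : support_condition pi M f theta x0)
  (pi_diff : forall y, differentiable (fun t => pi t x0 y) theta)
  (swap_pi : grad_integral_interchange mu (fun t y => pi t x0 y) theta)
  (swap_rpi :
     grad_integral_interchange mu (fun t y => r x0 y * pi t x0 y) theta)
  (N : nat) (N_ge1 : (1 <= N)%N)
  (Omega : measurableType dO) (P : probability Omega R)
  (y0 : 'I_N -> {RV P >-> Y}) (c0 : 'I_N -> {RV P >-> C})
  (y1 : 'I_N -> {RV P >-> Y})
  (sample_law : forall (i : 'I_N) (E : set (Y * C * Y)), measurable E ->
     P ((fun w => (y0 i w, c0 i w, y1 i w)) @^-1` E)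
       = trajectory_law pi M f theta x0 E)
  (sample_indep :
     mutually_independent P (fun i w => (y0 i w, c0 i w, y1 i w))) :
  let G := fun w : Omega => gradient_estimator pi f r theta x0
     (fun i => y0 i w) (fun i => c0 i w) (fun i => y1 i w) in
  (forall k : 'I_p, P.-integrable [set: Omega] (fun w => (G w 0 k)%:E)) ->
  forall k : 'I_p,
    ('E_P[(fun w => G w 0 k)%R]
       = (grad (expected_reward pi r x0) theta 0%R k)%:E)%E.
Proof.
move=> G _ k.
pose D (y : Y) := grad (fun t => pi t x0 y) theta 0 k.
pose sd i w := second_density pi f theta x0 (y0 i w, c0 i w, y1 i w).
have Dq0 y : pi theta x0 y = 0 -> D y = 0 by exact: grad_density_eq0.
have [/(_ k) iD _ _] := swap_pi.
have [/(_ k) irD _ /rowP/(_ k)] := swap_rpi.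
rewrite [in RHS]mxE => gradJ.
have gradrD y : grad (fun t => r x0 y * pi t x0 y) theta 0 k = r x0 y * D y.
  exact: grad_weighted_density.
pose J := grad (expected_reward pi r x0) theta 0 k.
have JE : J = \int[mu]_y (r x0 y * D y).
  by rewrite /J gradJ; apply: eq_Rintegral => y _; exact: gradrD.
have mr : measurable_fun setT (r x0).
  exact: (measurableT_comp r_meas (pair1_measurable x0)).
have meanS i : has_mean P (fun w => r x0 (y1 i w) * D (y1 i w) / sd i w) J.
  rewrite JE; apply: (has_mean_importance_reward f_meas supp sample_law i
    (b := fun y => r x0 y * D y)) => [|y /Dq0 ->]; last by rewrite mulr0.
  by apply: eq_integrable irD => // y _ /=; rewrite gradrD.
have meanT i j : has_mean P (fun w => r x0 (y0 j w) * (D (y1 i w) / sd i w)) 0.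
  apply: (has_mean_importance_baseline f_meas supp sample_law sample_indep)
    => //.
  exact: integral_grad_density.
have meanG : has_mean P (fun w => N%:R^-1 * \sum_(i < N)
    (r x0 (y1 i w) * D (y1 i w) / sd i w -
     N%:R^-1 * \sum_(j < N) r x0 (y0 j w) * (D (y1 i w) / sd i w)))
    (N%:R^-1 * \sum_(i < N) (J - N%:R^-1 * \sum_(j < N) 0)).
  apply/has_meanZ/has_mean_sum => i; apply: has_meanB => //.
  by apply/has_meanZ/has_mean_sum.
have N0 : N%:R != 0 :> R by rewrite pnatr_eq0 -lt0n.
(* Weight times score becomes [D / sd] by [density_grad_ln]; the advantage then splits into a reward
   term and the average over [j] of baseline terms, including [j = i]. *)
have GE w : G w 0 k = N%:R^-1 * \sum_(i < N)
    (r x0 (y1 i w) * D (y1 i w) / sd i w -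
     N%:R^-1 * \sum_(j < N) r x0 (y0 j w) * (D (y1 i w) / sd i w)).
  rewrite /G /gradient_estimator mxE summxE; congr (_ * _).
  apply: eq_bigr => i _; rewrite mxE mulrAC density_grad_ln// /advantage mulrBr.
  congr (_ - _); first by rewrite mulrC mulrA.
  by rewrite [LHS]mulrC -mulr_suml [RHS]mulrA.
rewrite unlock; under eq_integral do rewrite GE.
rewrite meanG.2 -/J; congr EFin.
(* The baseline means sum to 0 and [N] copies of [J] remain, averaged back to [J] since [N] is
   nonzero. *)
rewrite big1_eq mulr0 subr0 sumr_const card_ord.
by rewrite -[J *+ N]mulr_natl mulrA mulVf// mul1r.
Qed.
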